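(* Let $P:\mathcal{K}\to\mathbb{R}$ be a function defined on an arbitrary family $\mathcal{K}$ of conditional events. Then $P$ is coherent (in the betting-scheme sense) if and only if, for every integer $n\ge 1$ and for every finite subfamily $\mathcal{F}=\{E_1|H_1,\ldots,E_n|H_n\}$ of $\mathcal{K}$, denoting by $\mathcal{P}=(p_1,\ldots,p_n)$, $p_i=P(E_i|H_i)$, the restriction of $P$ to $\mathcal{F}$, it holds that $\mathcal{P}\in\mathcal{I}$, where $\mathcal{I}$ is the convex hull of the points $Q_1,\ldots,Q_m$ associated with the pair $(\mathcal{F},\mathcal{P})$.
   Context: Events are elements of a Boolean algebra (with sure event $\Omega$, impossible event $\emptyset$); $\overline{E}$ is the negation of $E$, $EH$ is the conjunction $E\wedge H$, $E\subseteq F$ means $E\overline{F}=\emptyset$, and an event is identified with its $\{0,1\}$-valued indicator. A conditional event $E|H$ has $H\neq\emptyset$. Let $\mathcal{F}=\{E_1|H_1,\ldots,E_n|H_n\}$ and $\mathcal{P}=(p_1,\ldots,p_n)\in\mathbb{R}^n$. Put $\mathcal{H}_n=H_1\vee\cdots\vee H_n$. The constituents $C_1,\ldots,C_m$ are the non-impossible conjunctions $A_1\cdots A_n$ with $A_i\in\{E_iH_i,\overline{E}_iH_i,\overline{H}_i\}$ which logically imply $\mathcal{H}_n$ (i.e. all of them except $\overline{H}_1\cdots\overline{H}_n$). Points: for $h=1,\ldots,m$, $Q_h=(q_{h1},\ldots,q_{hn})$, where $q_{hi}=1$ if $C_h\subseteq E_iH_i$, $q_{hi}=0$ if $C_h\subseteq\overline{E}_iH_i$,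 and $q_{hi}=p_i$ if $C_h\subseteq\overline{H}_i$. Random gain: for real numbers $s_1,\ldots,s_n$, $G=\sum_{i=1}^n s_iH_i(E_i-p_i)$, and $G_{\mathcal{H}_n}$ is the restriction of $G$ to $\mathcal{H}_n$; its values are those taken by $G$ on $C_1,\ldots,C_m$. Coherence (betting scheme): $P$ on $\mathcal{K}$ is coherent if and only if, for every integer $n$, every finite subfamily $\mathcal{F}=\{E_1|H_1,\ldots,E_n|H_n\}$ of $\mathcal{K}$, with $p_i=P(E_i|H_i)$, and all real numbers $s_1,\ldots,s_n$, one has $\min G_{\mathcal{H}_n}\le 0\le\max G_{\mathcal{H}_n}$. *)

(* Defs.v *)
From HB Require Import structures.
From mathcomp Require Import all_boot all_order all_algebra.
From mathcomp Require Import boolp classical_sets reals convex.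

Set Implicit Arguments.
Unset Strict Implicit.
Unset Printing Implicit Defensive.

Import Order.Theory GRing.Theory Num.Theory.
Local Open Scope ring_scope.

(* Events are the elements of a Boolean algebra B : ctbDistrLatticeType d;
   the conjunction is the meet, logical implication is the lattice order,
   the negation is ~`, and the impossible event is \bot. *)
Record cond_event d (B : ctbDistrLatticeType d) := CondEvent {
  conseq : B;
  given : B;
  given_neq0 : given != \bot%O
}.

Section Family.
Context {d : Order.disp_t} {B : ctbDistrLatticeType d}.
Variable n : nat.
Implicit Types (X : cond_event B) (F : 'I_n -> cond_event B).

Definition piece X (a : option bool) : B :=
  match a with
  | Some true => (conseq X `&` given X)%O
  | Some false => (~` (conseq X) `&` given X)%O
  | None => (~` (given X))%O
  end.

Definition family_given F : B := (\join_(i < n) given (F i))%O.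

Definition conjunction F (a : {ffun 'I_n -> option bool}) : B :=
  (\meet_(i < n) piece (F i) (a i))%O.

Definition constituents F : seq B :=
  [seq C <- [seq conjunction F a | a : {ffun 'I_n -> option bool}]
     | (C != \bot%O) && (C <= family_given F)%O].

Variable R : realType.
Implicit Types (p s : 'I_n -> R) (C : B).

Definition constituent_point F p C : 'rV[R]_n :=
  \row_i (if (C <= piece (F i) (Some true))%O then 1
          else if (C <= piece (F i) (Some false))%O then 0
          else p i).

Definition constituent_points F p : seq 'rV[R]_n := 
  [seq constituent_point F p C | C <- constituents F].

(* The value on C of the indicator of A. This is meaningful only if C decides A
   (C <= A or C <= ~` A); in [gain] below a constituent C always decides
   [given (F i)], and decides [conseq (F i)] whenever C <= given (F i). *)
Definition indicator_on C (A : B) : R := (C <= A)%O%:R.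

Definition gain F p s C : R :=
  \sum_(i < n) s i * indicator_on C (given (F i)) *
               (indicator_on C (conseq (F i)) - p i).

Definition gain_values F p s : seq R :=
  [seq gain F p s C | C <- constituents F].

Lemma piece_cover X C : C != \bot%O ->
  exists b, (C `&` piece X b)%O != \bot%O.
Proof.
move=> C0; apply/existsP; apply: contraNT C0; rewrite negb_exists.
move=> /forallP h.
have {}h b : (C `&` piece X b)%O = \bot%O by have := h b; rewrite negbK => /eqP.
rewrite -[C]meetx1 -(joinxC (given X)) meetUr (h None) joinx0.
rewrite -[given X]meet1x -(joinxC (conseq X)) meetUl meetUr.
by rewrite (h (Some true)) (h (Some false)) joinx0.
Qed.

Lemma conjunction_cover F C : C != \bot%O ->
  exists a, (C `&` conjunction F a)%O != \bot%O.
Proof.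
rewrite /conjunction; have := index_enum_uniq 'I_n.
elim: (index_enum _) C => [|i r IHr] C /=.
  by move=> _ C0; exists [ffun=> None]; rewrite big_nil meetx1.
move=> /andP[ir r_uniq] /(piece_cover (F i))[b] /(IHr _ r_uniq)[a Ca0].
exists [ffun j => if j == i then b else a j].
rewrite big_cons ffunE eqxx meetA (eq_big_seq (fun j => piece (F j) (a j)))//.
by move=> j jr; rewrite ffunE; case: eqP ir => // <-; rewrite jr.
Qed.

Lemma gain_values_nonempty F p s : (0 < n)%N -> gain_values F p s != [::].
Proof.
move=> n0; rewrite -size_eq0 size_map size_eq0.
pose i0 := Ordinal n0.
have [a ha] := conjunction_cover F (given_neq0 (F i0)).
have leF : (conjunction F a <= family_given F)%O.
  have le_i0 : (conjunction F a <= piece (F i0) (a i0))%O by exact: meets_inf.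
  apply: le_trans (joins_sup _ (isT : xpredT i0)).
  case: (a i0) le_i0 => [[]|] /= le_i0; [exact: le_trans le_i0 (leIr _ _)..|].
  by case/negP: ha; rewrite -lex0 -(meetxC (given (F i0))) leI2.
have : conjunction F a \in constituents F.
  rewrite mem_filter leF andbT fintype.image_f // andbT.
  by apply: contraNneq ha => ->; rewrite meetx0.
by apply: contraTneq => ->.
Qed.

End Family.

(* Meaningful for nonempty sequences; [gain_values F p s] is nonempty as soon
   as 0 < n, see [gain_values_nonempty]. *)
Definition seq_min (R : realType) (v : seq R) : R :=
  \big[Order.min/head 0 v]_(x <- v) x.
Definition seq_max (R : realType) (v : seq R) : R :=
  \big[Order.max/head 0 v]_(x <- v) x.

(* Betting scheme. The finite subfamilies of K are enumerated without
   repetition. *)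
Definition coherent d (B : ctbDistrLatticeType d) (R : realType)
    (K : set (cond_event B)) (P : K -> R) : Prop :=
  forall (n : nat) (F : 'I_n -> K) (s : 'I_n -> R),
    (0 < n)%N -> injective F ->
    let G := gain_values (fun i => val (F i)) (fun i => P (F i)) s in
    seq_min G <= 0 <= seq_max G.

Definition convex_hull (R : realType) (V : lmodType R) (A : set V) : set V :=
  smallest (@convex_set R V) A.

(* Main.v *)
Require Import Defs.
From HB Require Import structures.
From mathcomp Require Import all_boot all_order all_algebra.
From mathcomp Require Import boolp classical_sets reals convex.
From mathcomp Require Import interval_inference ring lra.

Set Implicit Arguments.
Unset Strict Implicit.
Unset Printing Implicit Defensive.

Import Order.Theory GRing.Theory Num.Theory.
Local Open Scope ring_scope.

(** On a constituent C the random gain with stakes s is the affine function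
    [payoff p s : v |-> sum_i s_i (v_i - p_i)] evaluated at the point Q attached
    to C ([gain_payoff]): if C implies that H_i is false, the i-th bet is called
    off, and the choice q_i = p_i makes its term vanish. As s varies, [payoff p s]
    ranges over all the affine functions that vanish at p. Coherence therefore
    says that no such function is positive (or, changing s into -s, negative) at
    all the points Q, i.e. that no hyperplane strictly separates p from them.

    If p lies in the convex hull, then the slab of the v at which the payoff lies
    between the least and the greatest gain is convex and contains every Q, so it
    contains p, where the payoff is 0 ([convex_payoff_itv], [payoff_self]).

    Conversely, a point outside a convex set is strictly separated from any
    finite part of that set ([finite_separation]); stakes that separate p from
    the Q's make every gain positive, a sure win.
    The separation goes by induction on the number of points: stakes that fail at
    a new point are corrected by stakes that separate p from the points where the
    former break even, on the segments from the new point to the others. *)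

Section Payoff.
Context {R : realType} {n : nat}.
Implicit Types (p s : 'I_n -> R) (v : 'rV[R]_n).

Definition payoff p s v : R := \sum_(i < n) s i * (v 0 i - p i).

Lemma payoff_self p s : payoff p s (\row_i p i) = 0.
Proof. by apply: big1 => i _; rewrite mxE subrr mulr0. Qed.

Lemma payoff_comb p s t (a b : R) v :
  payoff p (fun i => a * s i + b * t i) v = a * payoff p s v + b * payoff p t v.
Proof.
rewrite /payoff !mulr_sumr -big_split; apply: eq_bigr => i _ /=.
by rewrite mulrDl !mulrA.
Qed.

Lemma payoff_conv p s (k : {i01 R}) (x y : convex_lmodType 'rV[R]_n) :
  payoff p s (conv k x y) =
  k%:num * payoff p s x + (1 - k%:num) * payoff p s y.
Proof.
rewrite /payoff !mulr_sumr -big_split; apply: eq_bigr => i _ /=.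
by rewrite /conv/= !mxE /unstable.onem; lra.
Qed.

Lemma convex_payoff_itv p s (a b : R) :
  convex_set [set v | a <= payoff p s v <= b]%classic.
Proof.
move=> x y k; rewrite !inE /= => xab yab; rewrite payoff_conv.
have /andP[k0 k1] : 0 <= k%:num <= 1 by rewrite ge0 le1.
nra.
Qed.

(** Staking v - p itself yields |v - p|^2 at v; this is the only place where
    the Euclidean structure, hence the positivity of squares, matters. *)
Lemma payoff_diag_gt0 p v :
  v != \row_i p i -> 0 < payoff p (fun i => v 0 i - p i) v.
Proof.
move=> vp; rewrite lt_def sumr_ge0 ?andbT; last by move=> i _; rewrite -expr2 sqr_ge0.
apply: contraNneq vp => /psumr_eq0P v0; apply/eqP/rowP => i; rewrite mxE.
apply/eqP; rewrite -subr_eq0 -sqrf_eq0 expr2 v0//.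
by move=> j _; rewrite -expr2 sqr_ge0.
Qed.

(** Scaling up a functional that is positive on finitely many points makes it
    absorb any perturbation there; in [finite_separation] the perturbation is
    what restores positivity at a point where the functional vanishes. *)
Lemma dominating_scale (I : eqType) (r : seq I) (f g : I -> R) :
  {in r, forall i, 0 < f i} -> exists M, {in r, forall i, 0 < M * f i + g i}.
Proof.
move=> f0; exists (1 + \big[Num.max/0]_(i <- r) (- g i / f i)) => i ir.
have := le_bigmax_seq 0 i xpredT (fun i => - g i / f i) ir isT.
rewrite ler_pdivrMr ?f0// mulrDl mul1r; have := f0 _ ir; lra.
Qed.

(** Induction on the number of points of vs, with A fixed. Let s separate p from
    vs and suppose that it fails at a new point v0. Each segment [v0, v], with
    v in vs, meets the hyperplane on which the payoff of s vanishes, at a point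
    w v that is again in A by convexity. The points w v are no more numerous than
    vs, so the induction hypothesis gives a t separating p from all of them. The
    combination u of s and t whose payoff vanishes at v0 has at v the payoff of t
    at w v times the payoff difference of s between v and v0, both positive. A
    large multiple of u plus the stakes v0 - p is positive at v0 too. *)
Lemma finite_separation p (A : set (convex_lmodType 'rV[R]_n)) :
    convex_set A -> (\row_i p i : 'rV[R]_n) \notin A ->
  forall vs : seq 'rV[R]_n, {in vs, forall v, v \in A} ->
  exists s, {in vs, forall v, 0 < payoff p s v}.
Proof.
move=> convA pA vs; have [m] := ubnP (size vs).
elim: m vs => // m IHm [|v0 vs] /= size_vs vsA; first by exists p => v.
have v0A : v0 \in A by apply: vsA; rewrite mem_head.
have {}vsA v : v \in vs -> v \in A by move=> h; apply: vsA; rewrite inE h orbT.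
have [s s_gt0] := IHm vs size_vs vsA.
have [sv0|sv0] := ltP 0 (payoff p s v0).
  by exists s => v; rewrite inE => /predU1P[->//|/s_gt0].
(* the barycentric weight of v0 that annihilates the payoff of s *)
pose k v := payoff p s v / (payoff p s v - payoff p s v0).
have k01 v : v \in vs -> 0 <= k v <= 1.
  by move=> /s_gt0 sv; apply/andP; split; [apply: divr_ge0|rewrite ler_pdivrMr]; lra.
pose w v : 'rV[R]_n := k v *: v0 + (1 - k v) *: v.
have wA v : v \in vs -> w v \in A.
  move=> vvs; have /andP[k0 k1] := k01 _ vvs.
  exact: (convA v0 v (Itv01 k0 k1) v0A (vsA _ vvs)).
have [|_ /mapP[v /wA ? ->//]|t t_gt0] := IHm [seq w v | v <- vs].
  by rewrite size_map.
pose u i := - payoff p s v0 * t i + payoff p t v0 * s i.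
have u_v0 : payoff p u v0 = 0 by rewrite payoff_comb; lra.
have u_gt0 v : v \in vs -> 0 < payoff p u v.
  move=> vvs; have sv := s_gt0 _ vvs; have /andP[k0 k1] := k01 _ vvs.
  have D_gt0 : 0 < payoff p s v - payoff p s v0 by lra.
  have kD : k v * (payoff p s v - payoff p s v0) = payoff p s v.
    by rewrite divfK ?gt_eqF.
  suff -> : payoff p u v = (payoff p s v - payoff p s v0) * payoff p t (w v).
    by rewrite mulr_gt0// t_gt0// map_f.
  rewrite [payoff p t (w v)](payoff_conv p t (Itv01 k0 k1)) payoff_comb /=.
  set D := payoff p s v - payoff p s v0 in kD *.
  transitivity (k v * D * payoff p t v0 + (D - k v * D) * payoff p t v); last ring.
  by rewrite kD /D; ring.
have [M M_gt0] := dominating_scale (payoff p (fun i => v0 0 i - p i)) u_gt0.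
exists (fun i => M * u i + 1 * (v0 0 i - p i)) => v.
rewrite payoff_comb mul1r inE => /predU1P[->|]; last exact: M_gt0.
rewrite u_v0 mulr0 add0r payoff_diag_gt0//.
by apply: contraNneq pA => <-.
Qed.

End Payoff.

Section Constituents.
Context {d : Order.disp_t} {B : ctbDistrLatticeType d} {R : realType} {n : nat}.
Implicit Types (F : 'I_n -> cond_event B) (p s : 'I_n -> R) (C : B).

(** A nonimpossible C lies below exactly one of the three pieces E H, ~E H, ~H,
    and each of them determines the indicators that the gain reads. *)
Lemma gain_payoff F p s C : C \in constituents F ->
  gain F p s C = payoff p s (constituent_point F p C).
Proof.
rewrite mem_filter => /andP[/andP[C0 _] /mapP[a _ Ca]].
apply: eq_bigr => i _; rewrite mxE -mulrA; congr (_ * _).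
have disj (A : B) : (C <= ~` A)%O -> (C <= A)%O = false.
  by move=> CA'; apply: contraNF C0 => CA; rewrite -lex0 -(meetxC A) lexI CA.
have : (C <= piece (F i) (a i))%O by rewrite Ca; exact: meets_inf.
rewrite /indicator_on; case: (a i) => [[]|] /=; rewrite ?lexI.
- by move=> /andP[-> ->]; rewrite mul1r.
- by move=> /andP[/[dup] /disj -> -> ->]; rewrite mul1r.
- by move=> /disj ->; rewrite !andbF mul0r subrr.
Qed.

Lemma gain_valuesE F p s :
  gain_values F p s = [seq payoff p s v | v <- constituent_points F p].
Proof.
rewrite /constituent_points -map_comp; apply/eq_in_map => C /= CF.
exact: gain_payoff.
Qed.

End Constituents.

Lemma seq_min_gt (R : realType) (c : R) (v : seq R) :
  v != [::] -> {in v, forall x, c < x} -> c < seq_min v.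
Proof.
case: v => // x v _ cv; rewrite /seq_min big_seq; apply: lt_bigmin => //.
by apply: cv; rewrite mem_head.
Qed.

Lemma seq_min_max (R : realType) (v : seq R) :
  {in v, forall x, seq_min v <= x <= seq_max v}.
Proof.
move=> x xv; apply/andP; split.
- exact: (ge_bigmin_seq _ x xpredT id xv isT).
- exact: (le_bigmax_seq _ x xpredT id xv isT).
Qed.

Theorem theorem1 (R : realType) (d : Order.disp_t) (B : ctbDistrLatticeType d)
    (K : set (cond_event B)) (P : K -> R) :
  coherent P <->
  (forall (n : nat) (F : 'I_n -> K), (0 < n)%N -> injective F ->
     let Fs := fun i => val (F i) in
     let p := fun i => P (F i) in
     convex_hull [set` constituent_points Fs p]%classic (\row_i p i)).
Proof.
split=> [cohP n F n0 Finj Fs p A [convA subA]|hullP n F s n0 Finj].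
- apply/set_mem/negP => /negP pA.
  have [|s s_gt0] := finite_separation convA pA (vs := constituent_points Fs p).
    by move=> v vQ; apply/mem_set/subA.
  have min_le0 : seq_min (gain_values Fs p s) <= 0.
    by case: (andP (cohP n F s n0 Finj)).
  move: min_le0; apply/negP; rewrite -ltNge; apply: seq_min_gt.
    exact: gain_values_nonempty.
  by rewrite gain_valuesE => _ /mapP[v vQ ->]; exact: s_gt0.
- pose p i := P (F i); pose G := gain_values (fun i => val (F i)) p s.
  have slab := hullP n F n0 Finj
    [set v | seq_min G <= payoff p s v <= seq_max G]%classic.
  move: slab; rewrite /= payoff_self; apply; split.
    exact: convex_payoff_itv.
  by move=> v vQ /=; apply: seq_min_max; rewrite /G gain_valuesE map_f.
Qed.
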